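(* Let $\{X_k, k\in\mathbb{N}_+\}$ be a sequence of centered, integer-valued i.i.d. random variables in the domain of attraction of an $\alpha$-stable law with $\alpha\in(0,1)$, i.e. for each $x\in\mathbb{R}$, $\mathbb{P}(n^{-1/\alpha}S_n\le x)\to F_\alpha(x)$ as $n\to\infty$, where $S_n=X_1+\cdots+X_n$ and $F_\alpha$ is the distribution function of a stable law with characteristic function $\varphi(\theta)=\exp(-|\theta|^\alpha(C_1+iC_2\,\mathrm{sgn}\,\theta))$. Let $\{\xi(k),k\in\mathbb{Z}\}$ be a stationary sequence of real random variables, independent of $\{X_k\}$, and let $(u_n)$ be a sequence of reals such that $n\,\mathbb{P}(\xi(0)>u_n)\to\tau$ as $n\to\infty$ for some $\tau\ge 0$. Assume that $\{\xi(k)\}$ satisfies the conditions $D(u_n)$ and $D'(u_n)$ (defined in the context). Then for almost every realization of $\{S_n,n\in\mathbb{N}_+\}$, $$\mathbb{P}\Big(\max_{k\le n}\xi(S_k)\le u_n\Big)\xrightarrow[n\to\infty]{} e^{-\tau q},$$ where $q=\mathbb{P}(\forall k\in\mathbb{N}_+,\ S_k\neq 0)$ and the probability on the left is with respect to the scenery $\{\xi(k)\}$ with the realization of the walk held fixed.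
   Context: For integers $i_1<\cdots<i_p$ and $u\in\mathbb{R}$, write $F_{i_1,\ldots,i_p}(u)=\mathbb{P}(\xi(i_1)\le u,\ldots,\xi(i_p)\le u)$. Condition $D(u_n)$: there exist a family $(\alpha_{n,l})_{(n,l)\in\mathbb{N}^2}$ and a sequence $(l_n)$ of positive integers with $\alpha_{n,l_n}\to0$, $l_n=o(n)$, such that $|F_{i_1,\ldots,i_p,j_1,\ldots,j_{p'}}(u_n)-F_{i_1,\ldots,i_p}(u_n)F_{j_1,\ldots,j_{p'}}(u_n)|\le\alpha_{n,l}$ for all integers $i_1<\cdots<i_p<j_1<\cdots<j_{p'}$ with $j_1-i_p\ge l$, uniformly in $p,p'$. Condition $D'(u_n)$: there exists a sequence of integers $(k_n)$ with $k_n\to\infty$, $\frac{n^2}{k_n}\alpha_{n,l_n}\to0$ and $k_nl_n=o(n)$ (with $(\alpha_{n,l})$, $(l_n)$ from $D(u_n)$), such that $\lim_{n\to\infty} n\sum_{j=1}^{\lfloor n/k_n\rfloor}\mathbb{P}(\xi(0)>u_n,\xi(j)>u_n)=0$. *)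

(* Defs.v *)
From HB Require Import structures.
From mathcomp Require Import all_boot all_order all_algebra.
From mathcomp Require Import all_classical all_reals all_analysis.
Set Implicit Arguments. Unset Strict Implicit. Unset Printing Implicit Defensive.
Import Order.TTheory GRing.Theory Num.Theory.
Import numFieldNormedType.Exports.
Local Open Scope classical_set_scope.
Local Open Scope ring_scope.

Definition pr {d} {T : measurableType d} {R : realType} (P : probability T R)
  (A : set T) : R := fine (P A).

(* S_n = X_1 + ... + X_n ; the paper's X_k (k >= 1) is X (k-1) here *)
Definition walk {T : Type} (X : nat -> T -> int) (n : nat) (w : T) : int :=
  \sum_(i < n) X i w.

(* i.i.d. integer-valued random variables (int carries the discrete
   sigma-algebra: every subset is measurable). *)
Definition iid_int {d} {T : measurableType d} {R : realType}
  (P : probability T R) (X : nat -> T -> int) : Prop :=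
  [/\ (forall i (z : int), measurable [set w | X i w = z]),
      (forall (I : seq nat) (B : nat -> set int), uniq I ->
         pr P [set w | forall i, i \in I -> B i (X i w)]
         = \prod_(i <- I) pr P [set w | B i (X i w)]) &
      (forall i (z : int), P [set w | X i w = z] = P [set w | X 0%N w = z])].

(* F is the distribution function of a (non-degenerate) stable law whose
   characteristic function is exp(-|t|^a (C1 + i C2 sgn t));
   the characteristic function is written via its real/imaginary parts. *)
Definition stable_df {R : realType} (a C1 C2 : R) (F : R -> R) : Prop :=
  exists mu : probability R R,
    (forall t : R,
       (\int[mu]_x (cos (t * x))%:E
          = (expR (- (C1 * `|t| `^ a)) * cos (C2 * Num.sg t * `|t| `^ a))%:E)%E
       /\
       (\int[mu]_x (sin (t * x))%:E
          = (- (expR (- (C1 * `|t| `^ a)) * sin (C2 * Num.sg t * `|t| `^ a)))%:E)%E)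
    /\ (forall x : R, F x = fine (mu `]-oo, x]%classic)).

Definition stationary {d} {T : measurableType d} {R : realType}
  (P : probability T R) (xi : int -> T -> R) : Prop :=
  forall (m : int) (s : seq int) (B : int -> set R),
    (forall i, measurable (B i)) ->
    P [set w | forall i, i \in s -> B i (xi (i + m) w)]
    = P [set w | forall i, i \in s -> B i (xi i w)].

Definition Fset {T : Type} {R : realType} (xi : int -> T -> R) (s : seq int)
  (u : R) : set T := [set w | forall i, i \in s -> xi i w <= u].

Definition condD {d} {T : measurableType d} {R : realType}
  (P : probability T R) (xi : int -> T -> R) (u : nat -> R)
  (alpha : nat -> nat -> R) (l : nat -> nat) : Prop :=
  [/\ (forall n, (0 < l n)%N),
      (fun n => alpha n (l n)) @ \oo --> (0 : R),
      (fun n => (l n)%:R / n%:R) @ \oo --> (0 : R) &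
      forall (n m : nat) (I J : seq int),
        I != [::] -> J != [::] ->
        sorted (fun a b => a < b) I -> sorted (fun a b => a < b) J ->
        last 0 I < head 0 J ->
        m%:Z <= head 0 J - last 0 I ->
        `| pr P (Fset xi (I ++ J) (u n))
           - pr P (Fset xi I (u n)) * pr P (Fset xi J (u n)) | <= alpha n m].

(* Condition D'(u_n) relative to the family alpha and sequence (l_n) of D *)
Definition condD' {d} {T : measurableType d} {R : realType}
  (P : probability T R) (xi : int -> T -> R) (u : nat -> R)
  (alpha : nat -> nat -> R) (l : nat -> nat) : Prop :=
  exists k : nat -> nat,
    [/\ k n @[n --> \oo] --> \oo,
        (fun n => (n%:R ^+ 2 / (k n)%:R) * alpha n (l n)) @ \oo --> (0 : R),
        (fun n => ((k n * l n)%N)%:R / n%:R) @ \oo --> (0 : R) &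
        (fun n => n%:R * \sum_(1 <= j < (n %/ k n).+1)
            pr P [set w | u n < xi 0 w /\ u n < xi (j%:Z) w]) @ \oo --> (0 : R)].

(* Main.v *)
Require Import Defs.
From HB Require Import structures.
From mathcomp Require Import all_boot all_order all_algebra.
From mathcomp Require Import all_classical all_reals all_analysis.
From mathcomp Require Import ring lra zify.
Import Order.TTheory GRing.Theory Num.Theory.
Import numFieldNormedType.Exports.
Local Open Scope classical_set_scope.
Local Open Scope ring_scope.

(** Let R_n be the number of distinct sites among S_1, ..., S_n. Given the walk,
    the left-hand side is the probability that the scenery stays below u_n on R_n
    distinct sites, so the theorem splits into two independent facts.

    1. R_n / n tends to q almost surely, for every i.i.d. integer walk. Counting
    each site at its last visit, R_n lies between the number of k <= n such that
    S does not return to S_k within M >= n steps and m plus the same number for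
    a fixed m. Non-return within m steps is an m-dependent stationary event, with
    frequency q_m by Chebyshev's inequality, and q_m decreases to q; the passage
    to almost sure statements, and the control of the returns between times m
    and M, both come from a maximal inequality for stationary events. Only
    finitely many steps are ever involved at once, so no infinite product
    measure is needed.

    2. Along any n-indexed finite sets of s_n <= n sites, the probability that the
    scenery stays below u_n is exp (- s_n P(xi_0 > u_n)) + o(1). The sorted sites
    are cut into blocks of n / k_n consecutive sites separated by l_n discarded
    ones; D(u_n) makes blocks independent, and inside a block Bonferroni's
    inequality is used, where pairs of sites at distance at most n / k_n are
    controlled by D'(u_n) and the others by D(u_n). *)

Set Implicit Arguments. Unset Strict Implicit. Unset Printing Implicit Defensive.

(** * Real-valued probabilities and expectations *)

Section Probability.
Context d (T : measurableType d) (R : realType) (P : probability T R).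
Implicit Types A B : set T.

Lemma pr_EFin A : measurable A -> (pr P A)%:E = P A.
Proof. by move=> mA; rewrite /pr fineK // fin_num_measure. Qed.

Lemma pr_ge0 A : 0 <= pr P A.
Proof. by rewrite /pr fine_ge0. Qed.

Lemma pr_le A B : measurable A -> measurable B -> A `<=` B -> pr P A <= pr P B.
Proof.
by move=> mA mB AB; rewrite -lee_fin !pr_EFin //; apply: le_measure; rewrite ?inE.
Qed.

Lemma pr_le1 A : measurable A -> pr P A <= 1.
Proof. by move=> mA; rewrite -lee_fin pr_EFin // probability_le1. Qed.

Lemma pr_setT : pr P setT = 1.
Proof. by rewrite /pr probability_setT. Qed.

Lemma pr_split A B : measurable A -> measurable B ->
  pr P A = pr P (A `&` B) + pr P (A `&` ~` B).
Proof.
move=> mA mB; have mC := measurableC mB; apply: EFin_inj.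
rewrite EFinD !pr_EFin; do ?exact: measurableI => //.
rewrite -measureU; [|exact: measurableI|exact: measurableI|].
- by rewrite -setIUr setUv setIT.
- by rewrite setIACA setICr setI0.
- by [].
Qed.

Lemma pr_setU_le A B : measurable A -> measurable B ->
  pr P (A `|` B) <= pr P A + pr P B.
Proof.
move=> mA mB; rewrite -lee_fin EFinD !pr_EFin //; last exact: measurableU.
exact: measureU2.
Qed.

Lemma pr_bigcup_cvg (A : (set T)^nat) : (forall n, measurable (A n)) ->
  (forall n m, (n <= m)%N -> A n `<=` A m) ->
  pr P (A n) @[n --> \oo] --> pr P (\bigcup_n A n).
Proof.
move=> mA ndA; have mU : measurable (\bigcup_n A n) by exact: bigcupT_measurable.
apply: fine_cvg; rewrite pr_EFin //; apply: nondecreasing_cvg_mu => //.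
by move=> n m nm; apply/subsetPset/ndA.
Qed.

Lemma pr_bigcap_cvg (A : (set T)^nat) : (forall n, measurable (A n)) ->
  (forall n m, (n <= m)%N -> A m `<=` A n) ->
  pr P (A n) @[n --> \oo] --> pr P (\bigcap_n A n).
Proof.
move=> mA niA; have mI : measurable (\bigcap_n A n) by exact: bigcapT_measurable.
apply: fine_cvg; rewrite pr_EFin //; apply: nonincreasing_cvg_mu => //.
  by rewrite -ge0_fin_numE // fin_num_measure.
by move=> n m nm; apply/subsetPset/niA.
Qed.

Definition expect (f : T -> R) : R := \int[P]_x f x.
Definition integ (f : T -> R) : Prop := P.-integrable setT (EFin \o f).

Lemma integD f g : integ f -> integ g -> integ (fun w => f w + g w).
Proof. by move=> If Ig; have := integrableD measurableT If Ig. Qed.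

Lemma integZ c f : integ f -> integ (fun w => c * f w).
Proof. by move=> If; have := integrableZl measurableT c If. Qed.

Lemma integ_cst c : integ (fun=> c).
Proof. exact: finite_measure_integrable_cst. Qed.

Lemma integ_pred (b : T -> bool) :
  measurable [set w | b w] -> integ (fun w => (b w)%:R).
Proof.
move=> mb; rewrite /integ (_ : _ \o _ = fun w => (\1_[set w | b w] w)%:E).
  exact: integrable_indic.
apply/funext => w /=; congr (_%:E); rewrite indicE.
by congr (nat_of_bool _)%:R; apply/idP/idP => [?|]; rewrite inE.
Qed.

Lemma integ_sum I (s : seq I) (f : I -> T -> R) : (forall i, integ (f i)) ->
  integ (fun w => \sum_(i <- s) f i w).
Proof.
move=> If; elim: s => [|i s IHs].
  by under eq_fun do rewrite big_nil; exact: integ_cst.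
by under eq_fun do rewrite big_cons; exact: integD.
Qed.

Lemma expectD f g : integ f -> integ g ->
  expect (fun w => f w + g w) = expect f + expect g.
Proof. exact: RintegralD. Qed.

Lemma expectZ c f : integ f -> expect (fun w => c * f w) = c * expect f.
Proof. exact: RintegralZl. Qed.

Lemma expect_cst c : expect (fun=> c) = c.
Proof. by rewrite /expect Rintegral_cst //; have := pr_setT; rewrite /pr => ->; rewrite mulr1. Qed.

Lemma expect_pred (b : T -> bool) : measurable [set w | b w] ->
  expect (fun w => (b w)%:R) = pr P [set w | b w].
Proof.
move=> mb; rewrite /expect /Rintegral.
have -> : (fun w => (b w)%:R%:E) = fun w => (\1_[set w | b w] w)%:E :> \bar R.
  apply/funext => w /=; congr (_%:E); rewrite indicE.
  by congr (nat_of_bool _)%:R; apply/idP/idP => [?|]; rewrite inE.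
by rewrite integral_indic // setIT.
Qed.

Lemma expect_sum I (s : seq I) (f : I -> T -> R) : (forall i, integ (f i)) ->
  expect (fun w => \sum_(i <- s) f i w) = \sum_(i <- s) expect (f i).
Proof.
move=> If; elim: s => [|i s IHs].
  by rewrite big_nil -[RHS]expect_cst; congr expect; apply/funext => w; rewrite big_nil.
rewrite big_cons -IHs -expectD //; last exact: integ_sum.
by congr expect; apply/funext => w; rewrite big_cons.
Qed.

Lemma le_expect f g : integ f -> integ g -> (forall w, f w <= g w) ->
  expect f <= expect g.
Proof. by move=> If Ig fg; apply: le_Rintegral. Qed.

End Probability.

(** * Laws of random variables with countably many values *)

Section DiscreteLaw.
Context d (T : measurableType d) (R : realType) (P : probability T R).
Context (C : countType).
Implicit Types (U : T -> C) (A : set T) (E : set C).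

(** Values are indexed by their codes, so that a union over a countable type becomes a sequence of
    disjoint sets; numbers that code no value of [E] give the empty set. *)
Let piece U A E (n : nat) : set T :=
  if pickle_inv n is Some a then
    if `[< E a >] then A `&` [set w | U w = a] else set0
  else set0.

Let pieceP U A E n w :
  piece U A E n w <-> [/\ A w, E (U w) & pickle (U w) = n].
Proof.
rewrite /piece; split.
  case En: (pickle_inv n) => [a|//]; case: ifPn => // /asboolP Ea [Aw /= Uw].
  by split=> //; rewrite Uw //; have := @pickle_invK C n; rewrite En.
by case=> Aw EUw <-; rewrite pickleK_inv; case: ifPn => // /asboolP.
Qed.

Let measurable_piece U A E n : measurable A ->
  (forall a, measurable [set w | U w = a]) -> measurable (piece U A E n).
Proof.
move=> mA mU; rewrite /piece; case: pickle_inv => [a|] //.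
by case: ifP => // _; apply: measurableI.
Qed.

Let bigcup_piece U A E :
  A `&` [set w | E (U w)] = \bigcup_n piece U A E n.
Proof.
apply/seteqP; split => w; first by case=> Aw EUw; exists (pickle (U w)) => //; apply/pieceP.
by case=> n _ /pieceP[].
Qed.

Lemma measurable_discrete U A E : measurable A ->
  (forall a, measurable [set w | U w = a]) ->
  measurable (A `&` [set w | E (U w)]).
Proof.
move=> mA mU; rewrite bigcup_piece; apply: bigcupT_measurable => n.
exact: measurable_piece.
Qed.

(** Sigma-additivity carries the identity from single values to all sets of values. With [c = 1]
    this yields equality of laws; with [c] the probability of [A] and [A'] the whole space it yields
    independence. *)
Lemma discrete_law_transfer U U' A A' (c : R) :
  measurable A -> measurable A' ->
  (forall a, measurable [set w | U w = a]) ->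
  (forall a, measurable [set w | U' w = a]) ->
  (forall a, pr P (A `&` [set w | U w = a]) = c * pr P (A' `&` [set w | U' w = a])) ->
  forall E, pr P (A `&` [set w | E (U w)]) = c * pr P (A' `&` [set w | E (U' w)]).
Proof.
move=> mA mA' mU mU' eqUU' E.
apply: EFin_inj; rewrite EFinM !pr_EFin; do ?exact: measurable_discrete.
have triv V B : trivIset setT (piece V B E).
  by move=> i j _ _ [w [/pieceP[_ _ <-] /pieceP[_ _ <-]]].
rewrite !bigcup_piece !measure_bigcup; do ?[exact: triv | by move=> *; exact: measurable_piece].
rewrite -nneseriesZl; last by move=> *; exact: measure_ge0.
apply: eq_eseriesr => n _; rewrite /piece; case: pickle_inv => [a|].
  case: ifP => _; last by rewrite !measure0 mule0.
  transitivity (pr P (A `&` [set w | U w = a]))%:E.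
    by rewrite pr_EFin //; exact: measurableI.
  by rewrite eqUU' EFinM pr_EFin //; exact: measurableI.
by rewrite !measure0 mule0.
Qed.

End DiscreteLaw.

(** * Finite families of steps of the walk *)

Section Iid.
Context d (T : measurableType d) (R : realType) (P : probability T R).
Context (X : nat -> T -> int) (iidX : iid_int P X).

Lemma measurable_val i z : measurable [set w | X i w = z].
Proof. by case: iidX. Qed.

Lemma measurable_vals I z : measurable [set w | [seq X i w | i <- I] = z].
Proof.
elim: I z => [|i I IHI] [|x z].
- by rewrite (_ : [set _ | _] = setT) //; apply/seteqP; split.
- by rewrite (_ : [set _ | _] = set0) //; apply/seteqP; split.
- by rewrite (_ : [set _ | _] = set0) //; apply/seteqP; split.
rewrite (_ : [set _ | _] = [set w | X i w = x] `&` [set w | [seq X i w | i <- I] = z]).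
  exact: measurableI (measurable_val i x) (IHI z).
by apply/seteqP; split => w /= [-> ->].
Qed.

Lemma pr_vals I z : uniq I -> size I = size z ->
  pr P [set w | [seq X i w | i <- I] = z]
  = \prod_(x <- z) pr P [set w | X 0%N w = x].
Proof.
case: iidX => _ indX eqX uI sIz.
(* The value prescribed at [i] is read off from the position of [i] in [I], which is unambiguous
   because [I] has no repetition. *)
pose B i : set int := [set nth 0 z (index i I)].
have -> : [set w | [seq X i w | i <- I] = z]
        = [set w | forall i, i \in I -> B i (X i w)].
  apply/seteqP; split => w /=.
    by move=> eqz i iI; rewrite /B /= -eqz (nth_map 0%N) ?index_mem // nth_index.
  move=> BX; apply: (@eq_from_nth _ 0); rewrite size_map // => i iI.
  by rewrite (nth_map 0%N) // BX ?mem_nth // index_uniq.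
rewrite indX // (eq_bigr (fun i => pr P [set w | X 0%N w = nth 0 z (index i I)])).
  rewrite (big_nth 0%N) [RHS](big_nth 0) sIz.
  by apply: eq_big_nat => i /andP[_ iz]; rewrite index_uniq ?sIz.
by move=> i _; rewrite /pr /B /= eqX.
Qed.

Lemma pr_vals_size I z : size I != size z ->
  pr P [set w | [seq X i w | i <- I] = z] = 0.
Proof.
move=> sIz; rewrite (_ : [set _ | _] = set0); first by rewrite /pr measure0.
by apply/seteqP; split => w //= eqz; rewrite -eqz size_map eqxx in sIz.
Qed.

Lemma pr_vals_eqlaw I J (E : set (seq int)) : uniq I -> uniq J ->
  size I = size J ->
  pr P [set w | E [seq X i w | i <- I]] = pr P [set w | E [seq X i w | i <- J]].
Proof.
move=> uI uJ sIJ.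
have := @discrete_law_transfer _ _ _ P _ (fun w => [seq X i w | i <- I])
  (fun w => [seq X i w | i <- J]) setT setT 1 measurableT measurableT
  (measurable_vals I) (measurable_vals J) _ E.
rewrite !setTI mul1r; apply => z; rewrite !setTI mul1r.
have [sIz|sIz] := eqVneq (size I) (size z).
  by rewrite !pr_vals // -sIJ.
by rewrite !pr_vals_size // -sIJ.
Qed.

(** The product formula is first read on single lists [a] and [b]; then [a] is released to the event
    [E] with [b] fixed, and finally [b] to [F]. *)
Lemma pr_vals_indep I J (E F : set (seq int)) : uniq (I ++ J) ->
  pr P [set w | E [seq X i w | i <- I] /\ F [seq X i w | i <- J]]
  = pr P [set w | E [seq X i w | i <- I]] * pr P [set w | F [seq X i w | i <- J]].
Proof.
move=> uIJ; pose U I w := [seq X i w | i <- I].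
have mU K a : measurable [set w | U K w = a] by exact: measurable_vals.
have mE K G : measurable [set w | G (U K w)].
  by rewrite -[X in measurable X]setTI; apply: measurable_discrete.
have [uI _ uJ] := and3P (etrans (esym (cat_uniq _ _)) uIJ).
have indep1 a b : pr P ([set w | U I w = a] `&` [set w | U J w = b])
    = pr P [set w | U J w = b] * pr P [set w | U I w = a].
  have [sI|sI] := eqVneq (size I) (size a); last first.
    rewrite [X in _ * X]pr_vals_size // mulr0.
    rewrite (_ : _ `&` _ = set0); first by rewrite /pr measure0.
    by apply/seteqP; split => w //= [eqa _]; rewrite -eqa size_map eqxx in sI.
  have [sJ|sJ] := eqVneq (size J) (size b); last first.
    rewrite [X in X * _]pr_vals_size // mul0r.
    rewrite (_ : _ `&` _ = set0); first by rewrite /pr measure0.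
    by apply/seteqP; split => w //= [_ eqb]; rewrite -eqb size_map eqxx in sJ.
  rewrite !pr_vals // mulrC -big_cat -(@pr_vals (I ++ J)) ?size_cat ?sI ?sJ //.
  congr (pr P _); apply/seteqP; split => w /=.
    by case=> <- <-; rewrite map_cat.
  move/eqP; rewrite map_cat eqseq_cat ?size_map //.
  by case/andP => /eqP ? /eqP.
have indep2 b : pr P ([set w | U J w = b] `&` [set w | E (U I w)])
    = pr P [set w | U J w = b] * pr P [set w | E (U I w)].
  have := @discrete_law_transfer _ _ _ P _ (U I) (U I)
    [set w | U J w = b] setT (pr P [set w | U J w = b]) (mU J b) measurableT
    (mU I) (mU I) _ E.
  by rewrite setTI; apply => a; rewrite setTI setIC indep1.
have := @discrete_law_transfer _ _ _ P _ (U J) (U J)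
  [set w | E (U I w)] setT (pr P [set w | E (U I w)]) (mE I E) measurableT
  (mU J) (mU J) _ F.
by rewrite setTI; apply => b; rewrite setTI setIC indep2 mulrC.
Qed.

End Iid.

(** * Functionals of finitely many steps *)

Definition shift (k : nat) (x : nat -> int) : nat -> int := fun i => x (k + i)%N.

(** This replaces measurability with respect to the first [r] steps: such a functional factors
    through a list of integers, a countable type. *)
Definition fdep (V : Type) (r : nat) (f : (nat -> int) -> V) : Prop :=
  forall x y, (forall i, (i < r)%N -> x i = y i) -> f x = f y.

Lemma shift_shift i j x : shift i (shift j x) = shift (j + i) x.
Proof. by apply/funext => k; rewrite /shift addnA. Qed.

Lemma fdep_leq V r r' (f : (nat -> int) -> V) : (r <= r')%N -> fdep r f -> fdep r' f.
Proof. by move=> rr' fr x y xy; apply: fr => i ir; apply/xy/(leq_trans ir). Qed.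

Lemma fdep_shift V r k (f : (nat -> int) -> V) :
  fdep r f -> fdep (k + r) (fun x => f (shift k x)).
Proof. by move=> fr x y xy; apply: fr => i ir; apply: xy; rewrite ltn_add2l. Qed.

Lemma fdep_sum (V : zmodType) r n (f : nat -> (nat -> int) -> V) :
  (forall i, (i < n)%N -> fdep r (f i)) -> fdep r (fun x => \sum_(i < n) f i x).
Proof. by move=> fr x y xy; apply: eq_bigr => i _; apply: fr. Qed.

Lemma big_ord_add (V : zmodType) n m (f : nat -> V) :
  \sum_(i < n + m) f i = \sum_(i < n) f i + \sum_(i < m) f (n + i)%N.
Proof. by rewrite big_split_ord. Qed.

(** * The covering argument behind the maximal inequality *)

Section Covering.
Context (R : realFieldType) (lam : R) (M : nat).

Definition exceeds (a : nat -> R) : bool :=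
  has (fun n => lam * n%:R < \sum_(i < n) a i) (iota 1 M).

(* Disjoint intervals [j, j + n) with average above lam are chosen greedily
   from the left; they cover every index where exceeds holds. *)
Lemma exceeds_covering L a : 0 <= lam -> (forall i, 0 <= a i) ->
  lam * \sum_(j < L) (exceeds (fun i => a (j + i)%N))%:R <= \sum_(i < L + M) a i.
Proof.
move=> lam0; elim/ltn_ind: L a => -[|L] IH a a0.
  by rewrite big_ord0 mulr0; apply: sumr_ge0.
have [/hasP[n]|nex] := boolP (exceeds a); last first.
  rewrite big_ord_recl /= (_ : exceeds _ = false); last exact/negbTE.
  rewrite add0r addSn big_ord_recl; apply: (le_trans (IH L _ (fun i => a (1 + i)%N) _)) => //.
  by rewrite lerDr.
rewrite mem_iota add1n ltnS => /andP[n1 nM] an.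
have bnd l (c : nat -> bool) : lam * \sum_(j < l) (c j)%:R <= lam * l%:R.
  apply: ler_wpM2l => //; rewrite -[l in leRHS]card_ord -sumr_const.
  by apply: ler_sum => i _; case: (c i); rewrite ?lexx ?ler01.
(* An interval that covers all remaining starting points may run past them, but since [n <= M] it
   stays within the [M] extra terms on the right. *)
have [Ln|nL] := leqP L.+1 n.
  apply: le_trans (bnd L.+1 (fun j => exceeds (fun i => a (j + i)%N))) _.
  apply: le_trans (_ : lam * n%:R <= _).
    by rewrite ler_wpM2l // ler_nat.
  apply: le_trans (ltW an) _.
  have -> : (L.+1 + M = n + (L.+1 + M - n))%N by lia.
  by rewrite big_ord_add lerDl sumr_ge0.
have -> : L.+1 = (n + (L.+1 - n))%N by lia.
rewrite -addnA (big_ord_add _ _ a).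
rewrite (big_ord_add _ _ (fun j => (exceeds (fun i => a (j + i)%N))%:R)) mulrDr; apply: lerD.
  exact: le_trans (bnd n (fun j => exceeds (fun i => a (j + i)%N))) (ltW an).
under eq_bigr => j _ do under eq_fun => i do rewrite -addnA.
by apply: (IH _ _ (fun i => a (n + i)%N)) => //; lia.
Qed.

End Covering.

(** * Maximal and Chebyshev inequalities along the walk *)

Section Functionals.
Context d (T : measurableType d) (R : realType) (P : probability T R).
Context (X : nat -> T -> int) (iidX : iid_int P X).
Implicit Types b g : (nat -> int) -> bool.

Definition steps (w : T) : nat -> int := fun i => X i w.

Definition prf (b : (nat -> int) -> bool) : R := pr P [set w | b (steps w)].

Lemma event_vals r k b : fdep r b ->
  [set w | b (shift k (steps w))]
  = [set w | [set z | b (nth 0 z)] [seq X i w | i <- iota k r]].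
Proof.
move=> br; apply: eq_set => w /=.
(* The default value 0 extends the list beyond its [r] entries, where [b] does not look. *)
rewrite (br _ (nth 0 [seq X i w | i <- iota k r])) // => i ir.
by rewrite (nth_map 0%N) ?size_iota // nth_iota.
Qed.

Lemma measurable_fdep r k b : fdep r b -> measurable [set w | b (shift k (steps w))].
Proof.
move=> br; rewrite (event_vals _ br) -[X in measurable X]setTI.
by apply: measurable_discrete => //; exact: (measurable_vals iidX).
Qed.

Lemma measurable_fdep0 r b : fdep r b -> measurable [set w | b (steps w)].
Proof. exact: (@measurable_fdep r 0%N). Qed.

Lemma pr_shift r k b : fdep r b -> pr P [set w | b (shift k (steps w))] = prf b.
Proof.
move=> br; rewrite (event_vals _ br) /prf.
rewrite [X in _ = pr P X](event_vals 0%N br).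
by apply: (pr_vals_eqlaw iidX); rewrite ?iota_uniq ?size_iota.
Qed.

Lemma prf_ge0 b : 0 <= prf b. Proof. exact: pr_ge0. Qed.

Lemma prf_le1 r b : fdep r b -> prf b <= 1.
Proof. by move=> br; apply/pr_le1/measurable_fdep0/br. Qed.

Lemma pr_fdep_indep r k r' k' b b' : fdep r b -> fdep r' b' -> (k + r <= k')%N ->
  pr P [set w | b (shift k (steps w)) && b' (shift k' (steps w))] = prf b * prf b'.
Proof.
move=> br br' kk'; rewrite -(pr_shift k br) -(pr_shift k' br').
rewrite (event_vals k br) (event_vals k' br') -(pr_vals_indep iidX); last first.
  rewrite cat_uniq !iota_uniq /= andbT; apply/hasPn => i.
  rewrite !mem_iota; lia.
congr (pr P _); apply/seteqP; split => w /=.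
  case/andP => h h'; split.
    by move: (event_vals k br) => /seteqP[/(_ w h)].
  by move: (event_vals k' br') => /seteqP[/(_ w h')].
case=> h h'; apply/andP; split.
  by move: (event_vals k br) => /seteqP[_ /(_ w h)].
by move: (event_vals k' br') => /seteqP[_ /(_ w h')].
Qed.

Lemma integ_fdep r k b : fdep r b -> integ P (fun w => (b (shift k (steps w)))%:R).
Proof. by move=> br; apply/integ_pred/measurable_fdep/br. Qed.

Lemma expect_fdep r k b : fdep r b ->
  expect P (fun w => (b (shift k (steps w)))%:R) = prf b.
Proof.
by move=> br; rewrite expect_pred ?(pr_shift k br) //; exact: measurable_fdep br.
Qed.

Definition exceed_freq (lam : R) M (g : (nat -> int) -> bool) : (nat -> int) -> bool :=
  fun x => exceeds lam M (fun i => (g (shift i x))%:R).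

Lemma fdep_exceed_freq lam M r g : fdep r g -> fdep (M + r) (exceed_freq lam M g).
Proof.
move=> gr x y xy; apply: eq_in_has => n; rewrite mem_iota => nM; congr (_ < _).
apply: eq_bigr => -[i iN] _ /=; congr (nat_of_bool _)%:R; apply: gr => j jr.
by apply: xy; lia.
Qed.

(** The covering bound is integrated over [L] starting points. By stationarity each side becomes a
    multiple of one probability, and the boundary effect of size [M] disappears as [L] grows. *)
Lemma maximal_inequality lam M r g : 0 < lam -> fdep r g ->
  lam * prf (exceed_freq lam M g) <= prf g.
Proof.
move=> lam0 gr; have er := @fdep_exceed_freq lam M _ _ gr.
have key L : lam * (L%:R * prf (exceed_freq lam M g)) <= (L + M)%:R * prf g.
  pose f (j : 'I_L) w := (exceed_freq lam M g (shift j (steps w)))%:R : R.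
  pose h (j : 'I_(L + M)) w := (g (shift j (steps w)))%:R : R.
  have If j : integ P (f j) by exact: integ_fdep er.
  have Ih j : integ P (h j) by exact: integ_fdep gr.
  have Ef : expect P (fun w => \sum_(j < L) f j w) = L%:R * prf (exceed_freq lam M g).
    rewrite (expect_sum _ If) (eq_bigr (fun=> prf (exceed_freq lam M g))).
      by rewrite sumr_const card_ord mulr_natl.
    by move=> j _; exact: expect_fdep er.
  have Eh : expect P (fun w => \sum_(j < L + M) h j w) = (L + M)%:R * prf g.
    rewrite (expect_sum _ Ih) (eq_bigr (fun=> prf g)).
      by rewrite sumr_const card_ord mulr_natl.
    by move=> j _; exact: expect_fdep gr.
  rewrite -Ef -Eh -expectZ; last exact: integ_sum.
  apply: le_expect; [exact/integZ/integ_sum|exact: integ_sum|move=> w].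
  have := @exceeds_covering _ lam M L (fun i => (g (shift i (steps w)))%:R)
    (ltW lam0) (fun i => ler0n _ _).
  apply: le_trans; apply: ler_wpM2l; first exact: ltW.
  apply: ler_sum => j _; rewrite /f /exceed_freq.
  rewrite (_ : (fun i => _) = fun i => (g (shift (j + i) (steps w)))%:R) //.
  by apply/funext => i; rewrite shift_shift.
(* The passage to large [L] is made by contradiction: a gap [e] would outweigh the boundary term
   [M%:R * prf g]. *)
rewrite leNgt; apply/negP => lt.
pose e := lam * prf (exceed_freq lam M g) - prf g; have e0 : 0 < e by rewrite subr_gt0.
have [L Lbig] : exists L : nat, M%:R * prf g < L%:R * e.
  exists (Num.bound (M%:R * prf g / e)); rewrite -ltr_pdivrMr //.
  apply/archi_boundP/divr_ge0; last exact: ltW.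
  by apply: mulr_ge0 => //; exact: prf_ge0.
have := key L; rewrite natrD; move: Lbig; rewrite /e; nra.
Qed.

Section Chebyshev.
Context (m N : nat) (b : (nat -> int) -> bool) (bm : fdep m b).

(** Starting times are multiples of [m], so the summands read disjoint groups of steps and are
    independent. *)
Definition deviation (x : nat -> int) : R :=
  \sum_(k < N) ((b (shift (k * m) x))%:R - prf b).

Lemma fdep_deviation : fdep (N * m) deviation.
Proof.
apply: (@fdep_sum _ _ _ (fun k x => (b (shift (k * m) x))%:R - prf b)) => k kN x y xy.
congr (_%:R - _); apply: f_equal; apply: bm => i im; apply: xy.
have : (k.+1 * m <= N * m)%N by rewrite leq_mul2r kN orbT.
by rewrite mulSn; lia.
Qed.

Definition deviates (eps : R) (x : nat -> int) : bool := eps * N%:R < `|deviation x|.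

Lemma fdep_deviates eps : fdep (N * m) (deviates eps).
Proof. by move=> x y xy; rewrite /deviates (fdep_deviation xy). Qed.

Lemma expect_covariance j k : (j < N)%N -> (k < N)%N ->
  let f w := ((b (shift (j * m) (steps w)))%:R - prf b)
           * ((b (shift (k * m) (steps w)))%:R - prf b) in
  integ P f /\ expect P f <= (j == k)%:R.
Proof.
move=> jN kN f.
pose c x := b (shift (j * m) x) && b (shift (k * m) x).
have cr : fdep (N * m) c.
  have h i : (i < N)%N -> fdep (N * m) (fun x => b (shift (i * m) x)).
    move=> iN; have H := @fdep_shift _ _ (i * m) _ bm; apply: (fdep_leq _ H).
    by rewrite -mulSnr leq_mul2r iN orbT.
  by move=> x y xy; rewrite /c (h _ jN _ _ xy) (h _ kN _ _ xy).
(* Expanding the product reduces its expectation to those of indicators. *)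
have fE : f = fun w => (c (shift 0 (steps w)))%:R
    + (- prf b * (b (shift (j * m) (steps w)))%:R
    + (- prf b * (b (shift (k * m) (steps w)))%:R + prf b ^+ 2)).
  apply/funext => w; rewrite /f /c /= !shift_shift !add0n.
  by case: (b (shift (j * m) _)); case: (b (shift (k * m) _)) => /=; ring.
have Ic := integ_fdep 0 cr.
have Ij := integ_fdep (j * m) bm; have Ik := integ_fdep (k * m) bm.
have I1 : integ P (fun w => - prf b * (b (shift (k * m) (steps w)))%:R + prf b ^+ 2).
  by apply: integD; [exact: integZ | exact: integ_cst].
have I2 := integD (integZ (- prf b) Ij) I1.
split; first by rewrite fE; exact: integD.
rewrite fE expectD // expectD //; last exact: integZ.
rewrite expectD; [|exact: integZ|exact: integ_cst].
rewrite expect_cst !expectZ // !(expect_fdep _ bm) (expect_fdep _ cr).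
have -> : prf c + (- prf b * prf b + (- prf b * prf b + prf b ^+ 2)) = prf c - prf b ^+ 2.
  by ring.
have [jk|njk] := eqVneq j k.
  rewrite (_ : true%:R = 1 :> R) //; have := prf_le1 cr; have := sqr_ge0 (prf b); lra.
rewrite (_ : false%:R = 0 :> R) // subr_le0 /prf /c.
wlog jk : j k {jN kN f c cr fE Ic Ij Ik I1 I2} njk / (j < k)%N => [hw|].
  move: (njk); rewrite neq_ltn => /orP[|] lt; first exact: hw.
  by under eq_set do rewrite andbC; apply: hw => //; rewrite eq_sym.
(* For [j < k] the group starting at [j * m] ends before [k * m], so the covariance vanishes. *)
by rewrite (pr_fdep_indep bm bm) ?expr2 // -mulSnr leq_mul2r jk orbT.
Qed.

(** Only the [N] diagonal covariances contribute to the second moment of [deviation], each at most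
    1, so it is at most [N]; Markov's inequality for the square concludes. *)
Lemma chebyshev_deviates eps : 0 < eps -> eps ^+ 2 * N%:R * prf (deviates eps) <= 1.
Proof.
move=> eps0; have [->|N0] := posnP N; first by rewrite mulr0 mul0r ler01.
have N0' : 0 < N%:R :> R by rewrite ltr0n.
have dr := @fdep_deviates eps.
pose f (p : 'I_N * 'I_N) w := ((b (shift (p.1 * m) (steps w)))%:R - prf b)
           * ((b (shift (p.2 * m) (steps w)))%:R - prf b).
have If p : integ P (f p) by have [] := expect_covariance (ltn_ord p.1) (ltn_ord p.2).
suff : (eps * N%:R) ^+ 2 * prf (deviates eps) <= N%:R.
  move=> h; rewrite -(ler_pM2r N0') mul1r; apply: le_trans h.
  by rewrite le_eqVlt; apply/orP; left; apply/eqP; ring.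
rewrite -(expect_fdep 0 dr) -expectZ; last exact: integ_fdep dr.
apply: (@le_trans _ _ (expect P (fun w => \sum_(p <- index_enum ('I_N * 'I_N)%type) f p w))).
  apply: le_expect; [apply: integZ; exact: integ_fdep dr|exact: integ_sum|].
  move=> w; have -> : \sum_(p <- index_enum ('I_N * 'I_N)%type) f p w = deviation (steps w) ^+ 2.
    rewrite expr2 /deviation big_distrlr /= pair_big /=; exact: eq_bigr.
  rewrite /deviates -[X in _ <= X]real_normK ?num_real //.
  have -> : shift 0 (steps w) = steps w by apply/funext.
  case: ltP => h; last by rewrite mulr0 sqr_ge0.
  have eN : 0 <= eps * N%:R by rewrite mulr_ge0 // ltW.
  by rewrite mulr1 ler_sqr ?nnegrE // ltW.
rewrite expect_sum //.
apply: (@le_trans _ _ (\sum_(p : 'I_N * 'I_N) (val p.1 == val p.2)%:R)).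
  by apply: ler_sum => p _; have [] := expect_covariance (ltn_ord p.1) (ltn_ord p.2).
rewrite -(pair_big xpredT xpredT (fun i j : 'I_N => (val i == val j)%:R)) /=.
rewrite (eq_bigr (fun=> 1)); first by rewrite sumr_const card_ord.
move=> i _; rewrite (bigD1 i) //= eqxx big1 ?addr0 // => j ji.
by rewrite [_ == _](negbTE _) // eq_sym.
Qed.

End Chebyshev.
End Functionals.

(** * Averages of a bounded sequence over spaced translates *)

Lemma sum_translate_le (R : realDomainType) (a : nat -> R) n k :
  (forall i, `|a i| <= 1) ->
  `|\sum_(i < n) a i - \sum_(i < n) a (k + i)%N| <= (2 * k)%:R.
Proof.
move=> a1; elim: k => [|k IHk]; first by rewrite subrr normr0.
have step : \sum_(i < n) a (k.+1 + i)%N = \sum_(i < n) a (k + i)%N - a k + a (k + n)%N.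
  have := erefl (\sum_(i < n.+1) a (k + i)%N); rewrite {1}big_ord_recl big_ord_recr /= addn0.
  under eq_bigr => i _ do rewrite /bump /= addnA addn1.
  by move=> h; rewrite addrAC -h [a k + _]addrC addrK.
have -> : \sum_(i < n) a i - \sum_(i < n) a (k.+1 + i)%N
    = \sum_(i < n) a i - \sum_(i < n) a (k + i)%N + a k - a (k + n)%N.
  by rewrite step; ring.
rewrite (_ : (2 * k.+1)%:R = (2 * k)%:R + 1 + 1); last by rewrite mulnS !natrD; ring.
apply: le_trans (ler_normB _ _) _; rewrite lerD //.
by apply: le_trans (ler_normD _ _) _; rewrite lerD.
Qed.

(** The sum is replaced by the mean of its [N] translates by multiples of [m], each at a boundary
    cost of at most [2 * (N * m)]. After exchanging sums, an index outside [g] contributes at most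
    [eps] and one in [g] at most 1. *)
Lemma sum_block_average (R : realFieldType) (a : nat -> R) (g : nat -> bool) (eps : R) m N n :
  (0 < N)%N -> 0 <= eps -> (forall i, `|a i| <= 1) ->
  (forall i, ~~ g i -> `|\sum_(k < N) a (k * m + i)%N| <= eps * N%:R) ->
  `|\sum_(i < n) a i| <= eps * n%:R + \sum_(i < n) (g i)%:R + (2 * (N * m))%:R.
Proof.
move=> N0 eps0 a1 ag; have N0' : 0 < N%:R :> R by rewrite ltr0n.
rewrite -(ler_pM2l N0').
have -> : N%:R * `|\sum_(i < n) a i|
  = `|\sum_(k < N) (\sum_(i < n) a i - \sum_(i < n) a (k * m + i)%N)
      + \sum_(i < n) \sum_(k < N) a (k * m + i)%N|.
  rewrite [X in _ + X]exchange_big -big_split /=.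
  under [X in _ = `|X|]eq_bigr => k _ do rewrite subrK.
  by rewrite sumr_const card_ord normrMn mulr_natl.
apply: le_trans (ler_normD _ _) _; rewrite addrC mulrDr; apply: lerD.
  apply: le_trans (ler_norm_sum _ _ _) _.
  have -> : N%:R * (eps * n%:R + \sum_(i < n) (g i)%:R)
      = \sum_(i < n) (eps * N%:R + N%:R * (g i)%:R).
    by rewrite big_split /= sumr_const card_ord -mulr_sumr -[(eps * N%:R) *+ n]mulr_natr; ring.
  apply: ler_sum => i _; have [gi|ngi] := boolP (g i); last first.
    by rewrite mulr0 addr0 ag.
  rewrite mulr1; apply: le_trans (_ : N%:R <= _); last first.
    by rewrite lerDr mulr_ge0.
  apply: le_trans (ler_norm_sum _ _ _) _.
  rewrite -[N in leRHS]card_ord -sumr_const; exact: ler_sum.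
apply: le_trans (ler_norm_sum _ _ _) _.
rewrite mulr_natl -[N in X in _ <= X]card_ord -sumr_const card_ord.
apply: ler_sum => k _; apply: le_trans (sum_translate_le _ _ a1) _.
by rewrite ler_nat leq_mul2l leq_mul2r (ltnW (ltn_ord k)) orbT.
Qed.

(** * Visited sites counted at their last visit *)

Definition psum (x : nat -> int) (k : nat) : int := \sum_(i < k) x i.

Definition avoids (m : nat) (x : nat -> int) : bool :=
  all (fun j => psum x j.+1 != 0) (iota 0 m).

Definition nb_sites (n : nat) (x : nat -> int) : nat := size (undup [seq psum x k | k <- iota 1 n]).

Lemma fdep_psum k : fdep k (fun x => psum x k).
Proof. by move=> x y xy; apply: eq_bigr => i _; apply: xy. Qed.

Lemma fdep_avoids m : fdep m (avoids m).
Proof.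
move=> x y xy; apply: eq_in_all => j; rewrite mem_iota /= add0n => jm.
rewrite (@fdep_psum j.+1 x y) // => i ij; apply: xy; exact: leq_trans ij jm.
Qed.

Lemma fdep_nb_sites n : fdep n (nb_sites n).
Proof.
move=> x y xy; rewrite /nb_sites; congr (size (undup _)).
apply/eq_in_map => k; rewrite mem_iota => kn.
by apply: (fdep_psum (k := k)) => i ik; apply: xy; lia.
Qed.

Lemma psum_shift k j x : psum (shift k x) j = psum x (k + j) - psum x k.
Proof. by rewrite /psum big_ord_add addrC addKr. Qed.

Lemma avoidsP m k x :
  reflect (forall j, (k < j <= k + m)%N -> psum x j != psum x k) (avoids m (shift k x)).
Proof.
apply: (iffP allP) => h j.
  move=> kj; have := h (j - k.+1)%N; rewrite mem_iota psum_shift subr_eq0.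
  have -> : (k + (j - k.+1).+1 = j)%N by lia.
  by apply; lia.
by rewrite mem_iota psum_shift subr_eq0 => jm; apply: h; lia.
Qed.

Lemma avoids_leq m m' x : (m <= m')%N -> avoids m' x -> avoids m x.
Proof.
move=> mm' /allP h; apply/allP => j; rewrite mem_iota => jm; apply: h.
by rewrite mem_iota; lia.
Qed.

(* [undup] keeps last occurrences, so [nb_sites] counts the indices whose site
   is not visited later. *)
Lemma nb_sites_from_ge M n k x : (n <= M)%N ->
  (\sum_(i < n) avoids M (shift (k + i) x)
   <= size (undup [seq psum x j | j <- iota k n]))%N.
Proof.
elim: n k => [|n IHn] k nM; first by rewrite big_ord0.
rewrite big_ord_recl /= addn0.
under eq_bigr => i _ do rewrite /bump /= addnA addn1.
have := IHn k.+1 (ltnW nM).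
case: ifPn => [/mapP[j]|_] h; last first.
  by rewrite /= -[X in (_ <= X)%N]add1n; apply: leq_add => //; case: (avoids M (shift k x)).
case: (avoidsP M k x) => // av.
by move=> ej; have := av j; rewrite ej eqxx; move: h; rewrite mem_iota; lia.
Qed.

(** A last visit within the window is followed by [m] steps without return, unless it is so close to
    the end that these steps leave the window. The term [m] pays for those final indices. *)
Lemma nb_sites_from_le m n k x :
  (size (undup [seq psum x j | j <- iota k n])
   <= \sum_(i < n) avoids m (shift (k + i) x) + m)%N.
Proof.
elim: n k => [//|n IHn] k.
have [nm|mn] := leqP n.+1 m.
  apply: leq_trans (size_undup _) _; rewrite size_map size_iota; lia.
rewrite big_ord_recl /= addn0.
under eq_bigr => i _ do rewrite /bump /= addnA addn1.
have := IHn k.+1; case: ifPn => [_|/mapP h] /=.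
  by move=> h; rewrite -addnA; apply: leq_trans h (leq_addl _ _).
case: (avoidsP m k x) => [_|av] h'; first by rewrite addSn.
exfalso; apply: av => j kj; apply/eqP => ej; apply: h; exists j => //.
by rewrite mem_iota; lia.
Qed.

(** * Law of large numbers for the range *)

Section Range.
Context d (T : measurableType d) (R : realType) (P : probability T R).
Context (X : nat -> T -> int) (iidX : iid_int P X).

Definition escape : R := pr P [set w | forall k : nat, (0 < k)%N -> walk X k w != 0].

Local Notation q := escape.
Local Notation prf := (prf P X).
Local Notation steps := (steps X).

Lemma escape_bigcap :
  [set w | forall k : nat, (0 < k)%N -> walk X k w != 0]
  = \bigcap_m [set w | avoids m (steps w)].
Proof.
apply/seteqP; split => w /= h.
  by move=> m _; apply/allP => j _; exact: h.
move=> [//|k] _; have /allP := h k.+1 I.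
by apply; rewrite mem_iota; lia.
Qed.

Lemma escape_cvg : (fun m => prf (avoids m)) @ \oo --> q.
Proof.
rewrite /q escape_bigcap; apply: pr_bigcap_cvg => [m|m m' mm' w].
  exact: (measurable_fdep0 iidX (@fdep_avoids m)).
exact: avoids_leq.
Qed.

Lemma escape_le m : q <= prf (avoids m).
Proof.
have mA k := measurable_fdep0 iidX (@fdep_avoids k).
rewrite /q escape_bigcap; apply: pr_le => //; first exact: bigcapT_measurable.
by move=> w /(_ m I).
Qed.

(** With [escape_le], this bounds the probability of a first return between times [m] and [M] by
    [prf (avoids m) - q], uniformly in [M]. *)
Lemma prf_avoids_diff m M : (m <= M)%N ->
  prf (fun x => avoids m x && ~~ avoids M x) = prf (avoids m) - prf (avoids M).
Proof.
move=> mM; apply/eqP; rewrite eq_sym subr_eq addrC; apply/eqP.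
have mA k := measurable_fdep0 iidX (@fdep_avoids k).
rewrite /prf (pr_split P (mA m) (mA M)); congr (pr P _ + pr P _).
  by apply/seteqP; split => w /= => [[]//|h]; split=> //; exact: avoids_leq h.
apply/seteqP; split => w /=; first by case=> -> /negP.
by case/andP => -> /negP.
Qed.

(* Off the two exceptional events, the number of sites visited is squeezed
   between the counts of non-returns within M and within m steps. *)
Lemma nb_sites_near_escape (eps : R) m N M n x : (0 < N)%N -> (m <= M)%N ->
  (0 < n <= M)%N -> 0 < eps -> prf (avoids m) - q <= eps ->
  (2 * (N * m) + m)%:R <= eps * n%:R ->
  ~~ exceed_freq eps M (deviates P X m N (avoids m) eps) (shift 1 x) ->
  ~~ exceed_freq eps M (fun x => avoids m x && ~~ avoids M x) (shift 1 x) ->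
  `|(nb_sites n x)%:R - n%:R * q| <= 5 * eps * n%:R.
Proof.
(* The range starts at time 1, hence the shift of the walk by one step. *)
move=> N0 mM nM eps0 qm nlarge nG nC; set y := shift 1 x in nG nC *.
have freq g : ~~ exceed_freq eps M g y -> \sum_(i < n) (g (shift i y))%:R <= eps * n%:R.
  by move=> /hasPn/(_ n); rewrite mem_iota leNgt; apply; lia.
pose A k i : R := (avoids k (shift i y))%:R.
pose a i := A m i - prf (avoids m).
have p0 := prf_ge0 P X (avoids m); have p1 := prf_le1 iidX (@fdep_avoids m).
have a1 i : `|a i| <= 1.
  by rewrite /a /A; case: avoids => /=; rewrite ler_norml; apply/andP; split; lra.
have hsum : `|\sum_(i < n) a i| <= eps * n%:R + eps * n%:R + (2 * (N * m))%:R.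
  have := @sum_block_average R a (fun i => deviates P X m N (avoids m) eps (shift i y)) eps m N n
    N0 (ltW eps0) a1.
  move=> h; apply: le_trans (h _) _ => [i|]; last by rewrite lerD2r lerD2l freq.
  rewrite /deviates -leNgt /deviation; congr (_ <= _); congr `|_|.
  by apply: eq_bigr => k _; rewrite /a /A shift_shift addnC.
have sumaE : \sum_(i < n) a i = \sum_(i < n) A m i - n%:R * prf (avoids m).
  by rewrite /a sumrB sumr_const card_ord mulr_natl.
have lo : \sum_(i < n) A M i <= (nb_sites n x)%:R.
  have /andP[_ nM'] := nM.
  have := nb_sites_from_ge 1 x nM'; rewrite -(ler_nat R) natr_sum; apply: le_trans.
  by apply: ler_sum => i _; rewrite /A shift_shift.
have hi : (nb_sites n x)%:R <= \sum_(i < n) A m i + m%:R.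
  have := @nb_sites_from_le m n 1 x; rewrite -(ler_nat R) natrD natr_sum.
  move=> h; apply: le_trans h _; rewrite lerD2r.
  by apply: ler_sum => i _; rewrite /A shift_shift.
have AmM : \sum_(i < n) A m i - eps * n%:R <= \sum_(i < n) A M i.
  rewrite lerBlDr; apply: le_trans (_ : _ <= \sum_(i < n) A M i + \sum_(i < n)
    (avoids m (shift i y) && ~~ avoids M (shift i y))%:R) _; last first.
    by rewrite lerD2l (freq _ nC).
  rewrite -big_split /=; apply: ler_sum => i _; rewrite /A.
  by case: avoids; case: avoids => /=; rewrite ?addr0 ?add0r ?ler01.
move: hsum nlarge; rewrite sumaE natrD ler_norml => /andP[h1 h2] nlarge.
have n0 : 0 <= n%:R :> R by [].
have m0 : 0 <= m%:R :> R by [].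
have q1 : n%:R * (prf (avoids m) - q) <= n%:R * eps by rewrite ler_wpM2l.
have q2 : 0 <= n%:R * (prf (avoids m) - q) by rewrite mulr_ge0 // subr_ge0 escape_le.
have e0 := mulr_ge0 (ltW eps0) n0.
(* Errors of order [eps * n%:R] come from the block averages, the bad blocks, the boundary terms,
   and either the late returns or the distance from [prf (avoids m)] to [q]; five such terms cover
   each side. *)
by rewrite ler_norml; apply/andP; split; lra.
Qed.

(** The window of times is finite so that the event reads finitely many steps; [M] tends to infinity
    only in [nb_sites_ae]. *)
Definition badly_visited (eps : R) n0 M x : bool :=
  has (fun n => eps * n%:R < `|(nb_sites n x)%:R - n%:R * q|) (iota n0 M).

Lemma fdep_badly_visited eps n0 M : fdep (n0 + M) (badly_visited eps n0 M).
Proof.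
move=> x y xy; apply: eq_in_has => n; rewrite mem_iota => nM.
rewrite (@fdep_nb_sites n x y) // => i ni; apply: xy; lia.
Qed.

(** The point is that [n0] does not depend on [M]. One chooses [m], then [N], then [n0], and each of
    the two exceptional events receives probability at most [eta / 2]. *)
Lemma nb_sites_deviation (eps eta : R) : 0 < eps -> 0 < eta ->
  exists n0, forall M, prf (badly_visited eps n0 M) <= eta.
Proof.
move=> eps0 eta0; pose e := eps / 5.
have e0 : 0 < e by rewrite divr_gt0.
have d0 : 0 < Num.min e (e * eta / 2).
  by rewrite lt_min e0 divr_gt0 ?mulr_gt0.
(* The maximal inequality divides by [e], hence the target [e * eta / 2] for late returns; the bound
   [e] is required by [nb_sites_near_escape]. *)
have [m] : exists m, prf (avoids m) - q < Num.min e (e * eta / 2).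
  have [m _ hm] := cvgr_lt _ escape_cvg (q + Num.min e (e * eta / 2)) (ltac:(by rewrite ltrDl)).
  by exists m; rewrite ltrBlDl; apply: hm => /=.
rewrite lt_min => /andP[qm1 qm2].
(* Chebyshev's bound [1 / (e ^+ 2 * N%:R)] falls below [e * eta / 2] for this [N]. *)
pose N := (Num.bound (2 / (e ^+ 3 * eta))).+1.
have N2 : 2 <= e ^+ 3 * eta * N%:R.
  rewrite mulrC -ler_pdivrMr ?mulr_gt0 ?exprn_gt0 //.
  apply: le_trans (ltW (archi_boundP _)) _; last by rewrite ler_nat.
  by rewrite divr_ge0 ?mulr_ge0 ?exprn_ge0 ?ltW.
pose n0 := (Num.bound ((2 * (N * m) + m)%:R / e)).+1.
have n0P n : (n0 <= n)%N -> (2 * (N * m) + m)%:R <= e * n%:R.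
  move=> nn; rewrite mulrC -ler_pdivrMr //.
  apply: le_trans (ltW (archi_boundP _)) _; first by rewrite divr_ge0 // ltW.
  by rewrite ler_nat; apply: leq_trans nn.
exists n0 => M; pose M' := (n0 + M + m)%N.
set G := deviates P X m N (avoids m) e.
pose C x := avoids m x && ~~ avoids M' x.
have Gr : fdep (N * m) G by apply: fdep_deviates; exact: fdep_avoids.
have Cr : fdep M' C.
  move=> x y xy; rewrite /C (fdep_avoids xy).
  by rewrite (fdep_leq _ (@fdep_avoids m) xy) // leq_addl.
have eGr := @fdep_exceed_freq R e M' _ _ Gr.
have eCr := @fdep_exceed_freq R e M' _ _ Cr.
have sub : [set w | badly_visited eps n0 M (steps w)] `<=`
    [set w | exceed_freq e M' G (shift 1 (steps w))]
    `|` [set w | exceed_freq e M' C (shift 1 (steps w))].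
  move=> w /= /hasP[n]; rewrite mem_iota => nM bad.
  have [|nG] := boolP (exceed_freq e M' G _); first by left.
  have [|nC] := boolP (exceed_freq e M' C _); first by right.
  move: bad; rewrite ltNge => /negP[].
  have := @nb_sites_near_escape e m N M' n (steps w).
  rewrite /e mulrCA divff // mulr1; apply => //; rewrite -/e //; try lia.
  - exact: ltW.
  - by apply: n0P; lia.
apply: le_trans (pr_le P (measurable_fdep0 iidX (@fdep_badly_visited eps n0 M)) _ sub) _.
  apply: measurableU; [exact: (measurable_fdep iidX 1 eGr) |
    exact: (measurable_fdep iidX 1 eCr)].
apply: le_trans (pr_setU_le P (measurable_fdep iidX 1 eGr) (measurable_fdep iidX 1 eCr)) _.
rewrite (pr_shift iidX 1 eGr) (pr_shift iidX 1 eCr).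
have mG := maximal_inequality iidX M' e0 Gr.
have mC := maximal_inequality iidX M' e0 Cr.
rewrite prf_avoids_diff in mC; last exact: leq_addl.
have qM := escape_le M'.
have cG := chebyshev_deviates iidX N (@fdep_avoids m) e0.
rewrite -/G in cG.
have G0 := prf_ge0 P X G.
have cG' : prf G <= e * eta / 2.
  have e2 : 0 < e ^+ 2 by rewrite exprn_gt0.
  have N0 : 0 < N%:R :> R by rewrite ltr0n.
  rewrite -(ler_pM2l (mulr_gt0 e2 N0)); apply: le_trans cG _.
  rewrite -(ler_pM2l (ltr0Sn R 1)) mulr1; apply: le_trans N2 _.
  by rewrite le_eqVlt; apply/orP; left; apply/eqP; field.
by rewrite -(ler_pM2l e0) mulrDr; lra.
Qed.

Lemma nb_sites_ae :
  {ae P, forall w, (fun n => (nb_sites n (steps w))%:R / n%:R) @ \oo --> q}.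
Proof.
have mB eps n0 M : measurable [set w | badly_visited eps n0 M (steps w)].
  exact: (measurable_fdep0 iidX (@fdep_badly_visited eps n0 M)).
have aej (j : nat) : {ae P, forall w, exists n0, forall n, (n0 <= n)%N ->
    `|(nb_sites n (steps w))%:R - n%:R * q| <= j.+1%:R^-1 * n%:R}.
  pose e : R := j.+1%:R^-1; have e0 : 0 < e by rewrite invr_gt0.
  (* [D n0] says that some time from [n0] on is bad. It is an increasing union over windows, so
     bounds uniform in [M] pass to it, and the intersection over [n0] is null. *)
  pose D n0 := \bigcup_M [set w | badly_visited e n0 M (steps w)].
  have mD n0 : measurable (D n0) by apply: bigcupT_measurable => M.
  have mI : measurable (\bigcap_n0 D n0) by exact: bigcapT_measurable.
  exists (\bigcap_n0 D n0); split => //.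
    suff h : pr P (\bigcap_n0 D n0) <= 0.
      rewrite -pr_EFin //; congr (_%:E); apply: le_anti.
      by rewrite h pr_ge0.
    apply/ler_addgt0Pr => eta eta0; rewrite add0r.
    have [n0 hn0] := nb_sites_deviation e0 eta0.
    apply: (@le_trans _ _ (pr P (D n0))).
      by apply: pr_le => // w; apply.
    have ndB n m : (n <= m)%N -> [set w | badly_visited e n0 n (steps w)]
        `<=` [set w | badly_visited e n0 m (steps w)].
      move=> nm w /= /hasP[k kn hk]; apply/hasP; exists k => //.
      by move: kn; rewrite !mem_iota; lia.
    have hcvg := @pr_bigcup_cvg _ _ _ P _ (mB e n0) ndB.
    by apply: (cvgr_to_le hcvg); near=> M; exact: hn0.
  move=> w /= hw n0 _; apply: contrapT => nD; apply: hw; exists n0 => n nn0.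
  (* This is the shortest window from [n0] that contains [n]. *)
  rewrite leNgt; apply/negP => lt; apply: nD; exists (n - n0).+1 => //=.
  by apply/hasP; exists n => //; rewrite mem_iota; lia.
apply: filterS (ae_foralln aej) => w hw.
apply/cvgrPdist_le => eps eps0.
have [j jeps] : exists j : nat, j.+1%:R^-1 <= eps.
  exists (Num.bound eps^-1); rewrite invf_ple ?posrE //.
  apply: le_trans (ltW (archi_boundP _)) _; first by rewrite invr_ge0 ltW.
  by rewrite ler_nat.
have [n0 hn0] := hw j.
near=> n; have n1 : (0 < n)%N by near: n; exact: nbhs_infty_gt.
have n1' : 0 < n%:R :> R by rewrite ltr0n.
apply: le_trans jeps; rewrite distrC.
have -> : (nb_sites n (steps w))%:R / n%:R - q
    = ((nb_sites n (steps w))%:R - n%:R * q) / n%:R.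
  by field; rewrite gt_eqF.
rewrite normrM normfV (ger0_norm (ltW n1')) ler_pdivrMr //.
by apply: hn0; near: n; exact: nbhs_infty_ge.
Unshelve. all: by end_near. Qed.

End Range.

Lemma expRN_le (R : realType) (x : R) : 0 <= x -> expR (- x) <= 1 - x + x ^+ 2.
Proof.
move=> x0; have x1 : 0 < 1 + x by lra.
rewrite expRN; apply: (@le_trans _ _ (1 + x)^-1).
  by rewrite lef_pV2 ?posrE ?expR_gt0 // expR_ge1Dx.
(* The product of [1 + x] and [1 - x + x ^+ 2] is [1 + x ^+ 3]. *)
rewrite -[leLHS]mul1r ler_pdivrMr //; have := exprn_ge0 3 x0; lra.
Qed.

Lemma dist_expRN (R : realType) (x y : R) : 0 <= x -> 0 <= y ->
  `|expR (- x) - expR (- y)| <= `|x - y|.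
Proof.
wlog xy : x y / x <= y => [hw|] x0 y0.
  have [xy|/ltW yx] := leP x y; first exact: hw.
  by rewrite distrC (distrC x); exact: hw.
rewrite ger0_norm ?subr_ge0 ?ler_expR ?lerN2 // (distrC x) ger0_norm ?subr_ge0 //.
have -> : - y = - x + - (y - x) by ring.
rewrite expRD -[X in X - _]mulr1 -mulrBr -[leRHS]mul1r.
apply: ler_pM; rewrite ?expR_ge0 //.
- by rewrite subr_ge0 -expR0 ler_expR oppr_le0 subr_ge0.
- by rewrite -expR0 ler_expR oppr_le0.
by have := expR_ge1Dx (- (y - x)); lra.
Qed.

Lemma dist_mul_le (R : realDomainType) (a b c d : R) :
  0 <= b <= 1 -> 0 <= c <= 1 -> `|a * b - c * d| <= `|a - c| + `|b - d|.
Proof.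
move=> /andP[b0 b1] /andP[c0 c1].
have -> : a * b - c * d = (a - c) * b + c * (b - d) by ring.
apply: le_trans (ler_normD _ _) _; rewrite !normrM (ger0_norm b0) (ger0_norm c0).
by apply: lerD; rewrite ?ler_piMr ?ler_piMl.
Qed.

Local Notation ltz := (fun a b : int => a < b).

(** Increasing integers grow by at least one per index, so discarding [l] consecutive sites leaves
    the gap that mixing needs. *)
Lemma sorted_ltz_gap (s : seq int) i j : sorted ltz s -> (i <= j < size s)%N ->
  (j - i)%:Z <= nth 0 s j - nth 0 s i.
Proof.
move=> ss; elim: j => [|j IHj] /andP[ij js].
  by move: ij; rewrite leqn0 => /eqP ->; rewrite !subrr.
move: ij; rewrite leq_eqVlt => /orP[/eqP ->|ij]; first by rewrite subnn subrr.
have := IHj (ltac:(lia)); have := (sortedP 0 ss) j js.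
by move=> /=; lia.
Qed.

(** * The scenery at a fixed level [u] *)

Section Scenery.
Context d (T : measurableType d) (R : realType) (P : probability T R).
Context (xi : int -> {RV P >-> R}) (stat : stationary P (fun k => xi k)) (u : R).

Local Notation G s := (pr P (Fset (fun k => xi k) s u)).

Definition exceedance (i : int) : set T := [set w | u < xi i w].

Local Notation p := (pr P (exceedance 0)).

Lemma measurable_exceedance i : measurable (exceedance i).
Proof.
rewrite (_ : exceedance i = xi i @^-1` `]u, +oo[%classic).
  by rewrite -[X in measurable X]setTI; exact: measurable_funPT.
by apply/seteqP; split => w /=; rewrite in_itv /= andbT.
Qed.

Lemma Fset_cons i s :
  Fset (fun k => xi k) (i :: s) u = Fset (fun k => xi k) s u `&` ~` exceedance i.
Proof.
apply/seteqP; split => w /=.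
  move=> h; split; first by move=> j js; apply: h; rewrite inE js orbT.
  by apply/negP; rewrite -leNgt; apply: h; rewrite mem_head.
case=> h /negP; rewrite -leNgt => hi j; rewrite inE => /orP[/eqP ->//|].
exact: h.
Qed.

Lemma measurable_Fset s : measurable (Fset (fun k => xi k) s u).
Proof.
elim: s => [|i s IHs]; last first.
  rewrite Fset_cons; apply: measurableI => //.
  exact/measurableC/measurable_exceedance.
by rewrite (_ : Fset _ _ _ = setT) //; apply/seteqP; split.
Qed.

Local Hint Resolve measurable_exceedance measurable_Fset : core.

Lemma eq_Fset s s' : s =i s' -> Fset (fun k => xi k) s u = Fset (fun k => xi k) s' u.
Proof. by move=> ss'; apply/seteqP; split => w h i; [rewrite -ss'|rewrite ss'] => ?; apply: h. Qed.

Lemma pr_Fset_nil : G [::] = 1.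
Proof. by rewrite (_ : Fset _ _ _ = setT) ?pr_setT //; apply/seteqP; split. Qed.

Lemma pr_exceedance i : pr P (exceedance i) = p.
Proof.
have := stat i [:: 0] (B := fun=> `]u, +oo[%classic) (fun=> measurable_itv _).
have hE j : exceedance j = [set w | forall k, k \in [:: 0] -> `]u, +oo[%classic (xi (k + j) w)].
  apply/seteqP; split => w /=.
    by move=> h k; rewrite inE => /eqP ->; rewrite add0r in_itv /= andbT.
  by move=> /(_ 0 (mem_head _ _)); rewrite add0r in_itv /= andbT.
rewrite /pr (hE i) => ->; congr (fine (P _)).
by rewrite hE; apply/seteqP; split => w h n n0; have := h n n0; rewrite addr0.
Qed.

Lemma pr_exceedance2 i j :
  pr P (exceedance i `&` exceedance j) = pr P (exceedance 0 `&` exceedance (j - i)).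
Proof.
have := stat i [:: 0; j - i] (B := fun=> `]u, +oo[%classic) (fun=> measurable_itv _).
have hE k : exceedance k `&` exceedance (j - i + k)
  = [set w | forall n, n \in [:: 0; j - i] -> `]u, +oo[%classic (xi (n + k) w)].
  apply/seteqP; split => w /=.
    by case=> h1 h2 n; rewrite in_cons mem_seq1 => /orP[] /eqP ->;
      rewrite ?add0r /= in_itv /= andbT.
  move=> h; split.
    by have := h 0 (mem_head _ _); rewrite add0r in_itv /= andbT.
  by have := h (j - i); rewrite in_cons mem_seq1 eqxx orbT in_itv /= andbT => /(_ isT).
have := hE i; rewrite subrK /pr => -> ->; congr (fine (P _)).
have := hE 0; rewrite addr0 => ->.
by apply/seteqP; split => w h n n0; have := h n n0; rewrite addr0.
Qed.

Lemma pr_Fset_cons i s :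
  G (i :: s) = G s - pr P (Fset (fun k => xi k) s u `&` exceedance i).
Proof.
rewrite Fset_cons (pr_split P (measurable_Fset s) (measurable_exceedance i)).
by rewrite [X in X - _]addrC addrK.
Qed.

Lemma pr_Fset_cons_ge i s : G s - p <= G (i :: s).
Proof.
rewrite pr_Fset_cons lerD2l lerN2 -(pr_exceedance i); apply: pr_le => //.
exact: measurableI.
Qed.

Lemma pr_Fset_cons_le i s : G (i :: s) <= G s.
Proof. by rewrite pr_Fset_cons gerBl pr_ge0. Qed.

Lemma pr_Fset_cat_le s s' : G (s ++ s') <= G s'.
Proof. by elim: s => //= i s; apply/le_trans/pr_Fset_cons_le. Qed.

Lemma pr_Fset_cat_ge s s' : G s' - (size s)%:R * p <= G (s ++ s').
Proof.
elim: s => [|i s IHs] /=; first by rewrite mul0r subr0.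
apply: le_trans (pr_Fset_cons_ge i _); rewrite -natr1 mulrDl mul1r; lra.
Qed.

Lemma pr_Fset_ge s : 1 - (size s)%:R * p <= G s.
Proof. by have := pr_Fset_cat_ge s [::]; rewrite cats0 pr_Fset_nil. Qed.

Lemma pr_exceedance_setC_le i s :
  pr P (exceedance i `&` ~` Fset (fun k => xi k) s u)
  <= \sum_(j <- s) pr P (exceedance i `&` exceedance j).
Proof.
elim: s => [|j s IHs].
  rewrite big_nil (_ : _ `&` _ = set0); first by rewrite /pr measure0.
  by apply/seteqP; split => w //= [_ []].
have mI k : measurable (exceedance i `&` exceedance k) by exact: measurableI.
have mC : measurable (exceedance i `&` ~` Fset (fun k => xi k) s u).
  by apply: measurableI => //; exact: measurableC.
rewrite big_cons Fset_cons setCI setCK setIUr setUC.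
by apply: le_trans (pr_setU_le _ _ _) _ => //; rewrite lerD2l.
Qed.

(** One step of Bonferroni's inequality: an exceedance at [i] is lost in full, except for its
    overlap with exceedances at the other sites. *)
Lemma pr_Fset_cons_le_sum i s :
  G (i :: s) <= G s - p + \sum_(j <- s) pr P (exceedance i `&` exceedance j).
Proof.
have := pr_exceedance_setC_le i s.
have := pr_split P (measurable_exceedance i) (measurable_Fset s).
rewrite pr_exceedance pr_Fset_cons setIC; lra.
Qed.

Section Mixing.
Context (alp : R) (l : nat).
Hypothesis mixing : forall I J : seq int, I != [::] -> J != [::] ->
  sorted ltz I -> sorted ltz J -> last 0 I < head 0 J ->
  l%:Z <= head 0 J - last 0 I -> `|G (I ++ J) - G I * G J| <= alp.

Lemma mixing_ge0 : 0 <= alp.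
Proof.
apply: le_trans (mixing (I := [:: 0]) (J := [:: l.+1%:Z]) _ _ _ _ _ _) => //=.
by rewrite subr0; lia.
Qed.

(** Two events have the same covariance as their complements, so mixing for one-site lists
    applies. *)
Lemma far_exceedance2_le i j : i < j -> l%:Z <= j - i ->
  pr P (exceedance i `&` exceedance j) <= p ^+ 2 + alp.
Proof.
move=> ij lij.
have := mixing (I := [:: i]) (J := [:: j]) isT isT isT isT ij lij.
have Gk k : G [:: k] = 1 - p.
  by rewrite pr_Fset_cons pr_Fset_nil (eq_Fset (s' := [::])) // -(pr_exceedance k);
     rewrite (_ : Fset _ [::] _ = setT) ?setTI //; apply/seteqP; split.
rewrite /= !Gk pr_Fset_cons Gk ler_norml => /andP[_].
have -> : Fset (fun k => xi k) [:: j] u `&` exceedance i = exceedance i `&` ~` exceedance j.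
  rewrite Fset_cons setIC; congr (_ `&` _).
  by rewrite (_ : Fset _ [::] _ = setT) ?setTI //; apply/seteqP; split.
have := pr_split P (measurable_exceedance i) (measurable_exceedance j).
rewrite pr_exceedance; lra.
Qed.

Context (r : nat).

Let S := \sum_(1 <= j < r.+1) pr P (exceedance 0 `&` exceedance j%:Z).

Lemma close_sum_ge0 : 0 <= S.
Proof. by apply: sumr_ge0 => *; exact: pr_ge0. Qed.

Context (lr : (l <= r)%N) (r0 : (0 < r)%N).

(** Sites closer than [r] to [i] lie at distinct distances and together cost at most [S]; each
    farther site is handled by mixing, as [l <= r]. *)
Lemma exceedance2_sum_le i s : path ltz i s ->
  \sum_(j <- s) pr P (exceedance i `&` exceedance j) <= S + (size s)%:R * (p ^+ 2 + alp).
Proof.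
move=> is_s; have a0 := mixing_ge0.
have := is_s; rewrite path_sortedE; last exact: lt_trans.
case/andP => /allP is' ss.
have us : uniq s := sorted_uniq lt_trans ltxx ss.
have pa0 : 0 <= p ^+ 2 + alp by rewrite addr_ge0 // sqr_ge0.
pose f (k : nat) := pr P (exceedance 0 `&` exceedance k%:Z).
have f0 k : 0 <= f k by exact: pr_ge0.
apply: (@le_trans _ _ (\sum_(j <- s)
    (\sum_(1 <= k < r.+1) (j == i + k%:Z)%:R * f k + (p ^+ 2 + alp)))).
  rewrite !big_seq; apply: ler_sum => j /is' ij.
  have sum0 : 0 <= \sum_(1 <= k < r.+1) (j == i + k%:Z)%:R * f k.
    by apply: sumr_ge0 => k _; rewrite mulr_ge0.
  have [far|close] := leP (r%:Z : int) (j - i).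
    apply: le_trans (far_exceedance2_le ij _) _; first by lia.
    by rewrite lerDr.
  rewrite pr_exceedance2; pose k := `|j - i|%N.
  have -> : j - i = k%:Z by rewrite /k; lia.
  rewrite (bigD1_seq k) ?mem_index_iota ?iota_uniq //=; last by rewrite /k; lia.
  rewrite (_ : j == _); last by apply/eqP; rewrite /k; lia.
  rewrite mul1r -/(f k) -addrA lerDl addr_ge0 //.
  by apply: sumr_ge0 => k' _; rewrite mulr_ge0.
rewrite big_split /= big_const_seq count_predT iter_addr_0 [in leRHS]mulr_natl lerD2r.
(* After the exchange, the coefficient of [f k] counts the occurrences of [i + k] in [s], at most
   one. *)
rewrite exchange_big /=; apply: ler_sum => k _.
rewrite -mulr_suml -[leRHS]mul1r ler_wpM2r // -natr_sum lern1.
have -> : (\sum_(j <- s) (j == (i + k%:Z)%R) = count_mem (i + k%:Z)%R s)%N.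
  by elim: (s) => [|j t IHt]; rewrite ?big_nil // big_cons IHt.
by rewrite count_uniq_mem // leq_b1.
Qed.

Lemma pr_Fset_block_le s : sorted ltz s -> (size s <= r)%N ->
  G s <= 1 - (size s)%:R * p + (size s)%:R * (S + r%:R * (p ^+ 2 + alp)).
Proof.
elim: s => [|i s IHs] ss sr; first by rewrite pr_Fset_nil !mul0r subr0 addr0.
apply: le_trans (pr_Fset_cons_le_sum i s) _.
have := IHs (path_sorted ss) (ltnW sr).
have := exceedance2_sum_le ss.
have pa0 : 0 <= p ^+ 2 + alp by rewrite addr_ge0 ?mixing_ge0 // sqr_ge0.
have : (size s)%:R * (p ^+ 2 + alp) <= r%:R * (p ^+ 2 + alp).
  by rewrite ler_wpM2r // ler_nat ltnW.
rewrite /= -(natr1 (size s)) [in X in _ -> X]mulrDl [in X in _ -> X]mulrDl !mul1r; lra.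
Qed.

Let block_error := r%:R * (S + r%:R * (p ^+ 2 + alp)) + (r%:R * p) ^+ 2.
(** The cost of one block. The [l] discarded sites are paid twice, in the probability and in the
    exponent; [alp] pays for the factorization. *)
Let error := 2 * l%:R * p + alp + block_error.

(** Both quantities lie between [1 - r%:R * p] and that number plus [block_error], whose last term
    comes from [expRN_le]. *)
Lemma pr_Fset_block s : sorted ltz s -> size s = r ->
  `|G s - expR (- (r%:R * p))| <= block_error.
Proof.
move=> ss sr.
have := pr_Fset_block_le ss (eq_leq sr); have := pr_Fset_ge s; rewrite sr => lo hi.
have x0 : 0 <= r%:R * p by rewrite mulr_ge0 // pr_ge0.
have h1 := expRN_le x0; have h2 := expR_ge1Dx (- (r%:R * p)).
have e1 := sqr_ge0 (r%:R * p).
have e2 : 0 <= r%:R * (S + r%:R * (p ^+ 2 + alp)).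
  rewrite mulr_ge0 // addr_ge0 ?close_sum_ge0 // mulr_ge0 // addr_ge0 ?mixing_ge0 //.
  exact: sqr_ge0.
by rewrite /block_error ler_norml; apply/andP; split; lra.
Qed.

(** Induction on the number of blocks: the first [r] sites form a block, the next [l] are discarded,
    and mixing separates the block from the rest. *)
Lemma pr_Fset_expR K s : sorted ltz s -> (size s <= K.+1 * (r + l))%N ->
  `|G s - expR (- ((size s)%:R * p))| <= K%:R * error + (r + l)%:R * p.
Proof.
have p0 : 0 <= p by exact: pr_ge0.
have be0 : 0 <= block_error.
  rewrite addr_ge0 ?sqr_ge0 // mulr_ge0 // addr_ge0 ?close_sum_ge0 // mulr_ge0 //.
  by rewrite addr_ge0 ?mixing_ge0 // sqr_ge0.
have lp0 : 0 <= l%:R * p by rewrite mulr_ge0.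
have e0 : 0 <= error.
  by rewrite /error addr_ge0 // addr_ge0 ?mixing_ge0 // -mulrA mulr_ge0.
elim: K s => [|K IHK] s ss sK; last first.
  have [small|big] := leqP (size s) (r + l).
    apply: le_trans (IHK s ss _) _; first by rewrite (leq_trans small) // leq_pmull.
    by rewrite lerD2r ler_wpM2r // ler_nat.
  pose b := take r s; pose g := take l (drop r s); pose s' := drop (r + l) s.
  have sE : s = b ++ g ++ s'.
    by rewrite /b /g /s' addnC -drop_drop cat_take_drop cat_take_drop.
  have sb : size b = r by rewrite size_takel //; lia.
  have sg : size g = l by rewrite size_takel // size_drop; lia.
  have ss' : size s' = (size s - (r + l))%N by rewrite size_drop.
  have szE : (size s - l = r + size s')%N by rewrite ss'; lia.
  have sK' : (size s' <= K.+1 * (r + l))%N by rewrite ss' leq_subLR -mulSn.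
  have szl : (size s - (size s - l) = l)%N by lia.
  have sorted_b : sorted ltz b by exact: take_sorted.
  have sorted_s' : sorted ltz s' by exact: drop_sorted.
  have b_nil : b != [::] by rewrite -size_eq0 sb; lia.
  have s'_nil : s' != [::] by rewrite -size_eq0 ss'; lia.
  (* The last index in [b] is [r - 1] and the first in [s'] is [r + l]. *)
  have gap : l.+1%:Z <= head 0 s' - last 0 b.
    have := @sorted_ltz_gap s r.-1 (r + l) ss.
    rewrite -nth0 /s' nth_drop addn0 -nth_last sb /b nth_take; last by lia.
    have -> : (r + l - r.-1 = l.+1)%N by lia.
    by apply; lia.
  have D : `|G (b ++ s') - G b * G s'| <= alp by apply: mixing => //; lia.
  have B := pr_Fset_block sorted_b sb.
  have IH := IHK s' sorted_s' sK'.
  have hi := pr_Fset_cat_le g (b ++ s').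
  have lo := pr_Fset_cat_ge g (b ++ s').
  (* Only the set of sites matters, so [g] can be moved to the front, where removing it changes the
     probability by at most [l%:R * p]. *)
  have Gs : G s = G (g ++ b ++ s').
    by rewrite (eq_Fset (s' := g ++ b ++ s')) // sE => i; rewrite !mem_cat orbCA.
  rewrite -Gs sg in hi lo.
  have G01 t : 0 <= G t <= 1 by rewrite pr_ge0 pr_le1.
  have e01 (x : R) : 0 <= x -> 0 <= expR (- x) <= 1.
    by move=> x0; rewrite expR_ge0 -expR0 ler_expR oppr_le0.
  have M := @dist_mul_le _ (G b) (G s') (expR (- (r%:R * p))) (expR (- ((size s')%:R * p)))
    (G01 _) (e01 _ (mulr_ge0 (ler0n _ _) p0)).
  have E : expR (- (r%:R * p)) * expR (- ((size s')%:R * p)) = expR (- ((size s - l)%:R * p)).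
    by rewrite szE natrD mulrDl opprD expRD.
  have L : `|expR (- ((size s - l)%:R * p)) - expR (- ((size s)%:R * p))| <= l%:R * p.
    apply: le_trans (dist_expRN _ _) _; rewrite ?mulr_ge0 //.
    by rewrite -mulrBl -opprB -natrB ?leq_subr // normrM normrN !ger0_norm // szl.
  rewrite E in M; rewrite -(natr1 K) mulrDl mul1r /error.
  move: B IH D M L; rewrite !ler_norml.
  set A1 := `|G b - _|; set A2 := `|G s' - _|.
  move=> B IH /andP[D1 D2] /andP[M1 M2] /andP[L1 L2].
  have {}B : A1 <= block_error by rewrite /A1 ler_norml.
  have {}IH : A2 <= K%:R * error + (r + l)%:R * p by rewrite /A2 ler_norml.
  by rewrite /error in IH; apply/andP; split; lra.
(* With at most [r + l] sites, both quantities lie between [1 - (r + l)%:R * p] and 1. *)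
rewrite mul1n in sK; rewrite mul0r add0r.
have h1 := pr_Fset_ge s; have h2 := pr_le1 P (measurable_Fset s).
have x0 : 0 <= (size s)%:R * p by rewrite mulr_ge0.
have h3 := expR_ge1Dx (- ((size s)%:R * p)).
have h4 : expR (- ((size s)%:R * p)) <= 1 by rewrite -[X in _ <= X]expR0 ler_expR oppr_le0.
have h5 : (size s)%:R * p <= (r + l)%:R * p by rewrite ler_wpM2r // ler_nat.
by rewrite ler_norml; apply/andP; split; lra.
Qed.

End Mixing.
End Scenery.

(** * The scenery along growing sets of sites *)

Section SceneryLimit.
Context d (T : measurableType d) (R : realType) (P : probability T R).
Context (xi : int -> {RV P >-> R}) (stat : stationary P (fun k => xi k)).
Context (u : nat -> R) (tau : R).
Hypothesis tau_lim : (fun n : nat => n%:R * pr P [set w | u n < xi 0 w]) @ \oo --> tau.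
Context (a : nat -> nat -> R) (l : nat -> nat).
Hypothesis D : condD P (fun k => xi k) u a l.
Hypothesis D' : condD' P (fun k => xi k) u a l.

Lemma cvg_inv_nat (k : nat -> nat) : k n @[n --> \oo] --> \oo ->
  (fun n => (k n)%:R^-1) @ \oo --> (0 : R).
Proof.
move=> /cvgnyPge ky; apply/cvgrPdist_le => e e0.
near=> n; rewrite sub0r normrN ger0_norm ?invr_ge0 //.
have kn : ((Num.bound e^-1).+1 <= k n)%N by near: n; exact: ky.
have k0 : 0 < (k n)%:R :> R by rewrite ltr0n; apply: leq_trans kn.
rewrite invf_ple ?posrE //; apply: le_trans (ltW (archi_boundP _)) _.
  by rewrite invr_ge0 ltW.
by rewrite ler_nat ltnW.
Unshelve. all: by end_near. Qed.

Lemma pr_Fset_sub_expR_cvg (s : nat -> seq int) :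
  (forall n, sorted (fun a b => a < b) (s n)) -> (forall n, (size (s n) <= n)%N) ->
  (fun n => pr P (Fset (fun k => xi k) (s n) (u n))
     - expR (- ((size (s n))%:R * pr P [set w | u n < xi 0 w]))) @ \oo --> (0 : R).
Proof.
move=> ss sn; have [l0 _ _ mix] := D; have [k [ky ka kl kS]] := D'.
pose p n := pr P [set w | u n < xi 0 w].
pose A n := n%:R ^+ 2 / (k n)%:R * a n (l n).
pose L n := (k n * l n)%:R / n%:R : R.
pose S n := \sum_(1 <= j < (n %/ k n).+1) pr P [set w | u n < xi 0 w /\ u n < xi j%:Z w].
(* This majorizes the bound of [pr_Fset_expR] with [2 * k n] rounds and [r = n %/ k n]. Gaps give 4,
   plus 1 from the final remainder; [A n] dominates two mixing terms, each with factor 2; squares of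
   [r%:R * p n] occur twice in each round. *)
pose B n := 5 * (L n * (n%:R * p n)) + 4 * A n + 2 * (n%:R * S n)
  + 4 * ((n%:R * p n) ^+ 2 * (k n)%:R^-1) + n%:R * p n * (k n)%:R^-1.
have B0 : B n @[n --> \oo] --> (0 : R).
  have np : (fun n => n%:R * p n) @ \oo --> tau := tau_lim.
  have kV := cvg_inv_nat ky.
  have -> : 0 = 5 * (0 * tau) + 4 * 0 + 2 * 0 + 4 * ((tau * tau) * 0) + tau * 0 :> R by ring.
  rewrite /B; under eq_fun do rewrite (expr2 (_ * _)).
  by do ![apply: cvgD]; do ?[apply: cvgM]; do ?exact: cvg_cst.
apply/norm_cvg0P; apply: (@squeeze_cvgr _ _ _ _ (fun=> 0) B) => //; last exact: cvg_cst.
near=> n.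
have n1 : (0 < n)%N by near: n; exact: nbhs_infty_gt.
have k1 : (0 < k n)%N by near: n; move/cvgnyPge: ky; apply.
have kln : (k n * l n <= n)%N.
  rewrite -(ler_nat R) -[leRHS]mul1r -ler_pdivrMr ?ltr0n //; apply: ltW.
  by near: n; apply: (cvgr_lt _ kl); exact: ltr01.
rewrite normr_ge0 /=.
pose r := (n %/ k n)%N.
have lr : (l n <= r)%N by rewrite leq_divRL // mulnC.
have r1 : (0 < r)%N := leq_trans (l0 n) lr.
have rk : (r * k n <= n)%N by exact: leq_trunc_div.
(* Since [r] is rounded down but positive, [n < r.+1 * k n <= 2 * r * k n], which explains the
   doubled number of blocks. *)
have szle : (size (s n) <= (2 * k n).+1 * (r + l n))%N.
  apply: leq_trans (sn n) _.
  have : (n < r.+1 * k n)%N by exact: ltn_ceil.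
  by have : (k n <= r * k n)%N by [rewrite leq_pmull]; nia.
have := @pr_Fset_expR _ _ _ P xi stat (u n) (a n (l n)) (l n) (mix n (l n))
  r lr r1 (2 * k n) (s n) (ss n) szle.
have an0 := mixing_ge0 (mix n (l n)).
have S0 := @close_sum_ge0 _ _ _ P xi (u n) r.
rewrite -/(p n) -/(S n) in S0 *.
move=> h; apply: le_trans h _.
have p0 : 0 <= p n by exact: pr_ge0.
have nR : 0 < n%:R :> R by rewrite ltr0n.
have kR : 1 <= (k n)%:R :> R by rewrite ler1n.
have kR0 : 0 < (k n)%:R :> R by rewrite ltr0n.
have lR : 0 <= (l n)%:R :> R by [].
have rR : 0 <= r%:R :> R by [].
have klR : (k n)%:R * (l n)%:R <= n%:R :> R by rewrite -natrM ler_nat.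
have rkR : r%:R * (k n)%:R <= n%:R :> R by rewrite -natrM ler_nat.
have knR : (k n)%:R <= n%:R :> R by rewrite ler_nat (leq_trans _ kln) // leq_pmulr.
rewrite natrM natrD.
set K := (k n)%:R in kR kR0 klR rkR knR *; set N := n%:R in nR klR rkR knR *.
set rr := r%:R in rR rkR *; set al := a n (l n) in an0 *; set ll := (l n)%:R in lR klR *.
have rN : rr <= N / K by rewrite ler_pdivlMr.
have e1 : L n * (N * p n) = K * ll * p n.
  by rewrite /L natrM; field; rewrite gt_eqF.
have e2 : A n = N ^+ 2 / K * al by [].
have e3 : K * al <= A n.
  rewrite e2 ler_wpM2r // ler_pdivlMr // -expr2 ler_sqr ?nnegrE //; exact: ltW.
have rr2 : K * rr ^+ 2 <= N ^+ 2 / K.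
  rewrite ler_pdivlMr // (_ : K * rr ^+ 2 * K = (rr * K) ^+ 2); last by ring.
  by rewrite ler_sqr ?nnegrE // ?mulr_ge0 // ltW.
have e4 : K * (rr * S n) <= N * S n by rewrite mulrA (mulrC K) ler_wpM2r.
have e5 : K * rr ^+ 2 * p n ^+ 2 <= (N * p n) ^+ 2 * K^-1.
  by rewrite exprMn (mulrAC (N ^+ 2)) ler_wpM2r ?sqr_ge0.
have e6 : K * rr ^+ 2 * al <= A n by rewrite e2 ler_wpM2r.
have e7 : rr * p n <= N * p n * K^-1 by rewrite (mulrAC N) ler_wpM2r.
have e8 : ll * p n <= K * ll * p n by rewrite ler_wpM2r // ler_peMl.
rewrite /B -/N -/K e1; lra.
Unshelve. all: by end_near. Qed.

Lemma pr_Fset_cvg (s : nat -> seq int) (q : R) :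
  (forall n, sorted (fun a b => a < b) (s n)) -> (forall n, (size (s n) <= n)%N) ->
  (fun n => (size (s n))%:R / n%:R) @ \oo --> q ->
  (fun n => pr P (Fset (fun k => xi k) (s n) (u n))) @ \oo --> expR (- (tau * q)).
Proof.
move=> ss sn sq; have h := pr_Fset_sub_expR_cvg ss sn.
have hp : (fun n => (size (s n))%:R * pr P [set w | u n < xi 0 w]) @ \oo --> tau * q.
  rewrite mulrC; apply: cvg_trans (cvgM sq tau_lim); apply: near_eq_cvg.
  near=> n; have n0 : (0 < n)%N by near: n; exact: nbhs_infty_gt.
  by rewrite /= mulrA divfK // pnatr_eq0 -lt0n.
have he : (fun n => expR (- ((size (s n))%:R * pr P [set w | u n < xi 0 w]))) @ \oo
    --> expR (- (tau * q)).
  by apply: continuous_cvg; [exact: continuous_expR | exact: cvgN].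
rewrite -[expR _]add0r; apply: cvg_trans (cvgD h he).
by apply: near_eq_cvg; near=> n; rewrite /= subrK.
Unshelve. all: by end_near. Qed.

End SceneryLimit.

(** * Combining the range and the scenery *)

Unset Implicit Arguments.

Theorem theorem1 (R : realType)
  (d1 d2 : measure_display) (T1 : measurableType d1) (T2 : measurableType d2)
  (P1 : probability T1 R) (P2 : probability T2 R)
  (X : nat -> T1 -> int) (alpha C1 C2 : R) (F : R -> R)
  (xi : int -> {RV P2 >-> R}) (u : nat -> R) (tau : R) :
  iid_int P1 X ->
  0 < alpha < 1 -> 0 < C1 ->
  stable_df alpha C1 C2 F ->
  (forall x : R,
     (fun n : nat => pr P1 [set w | n%:R `^ (- alpha^-1) * (walk X n w)%:~R <= x])
       @ \oo --> F x) ->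
  stationary P2 (fun k => xi k) ->
  0 <= tau ->
  (fun n : nat => n%:R * pr P2 [set w | u n < xi 0 w]) @ \oo --> tau ->
  (exists (a : nat -> nat -> R) (l : nat -> nat),
      condD P2 (fun k => xi k) u a l /\ condD' P2 (fun k => xi k) u a l) ->
  {ae P1, forall om,
     (fun n : nat =>
        pr P2 [set w | forall k : nat, (1 <= k <= n)%N -> xi (walk X k om) w <= u n])
       @ \oo --> expR (- (tau * pr P1 [set om' | forall k : nat, (0 < k)%N -> walk X k om' != 0]))}.
Proof.
move=> iidX _ _ _ _ stat _ tau_lim [a [l [D D']]].
apply: filterS (nb_sites_ae iidX) => om range_lim.
(* Mixing concerns strictly increasing lists; removing repetitions and sorting leaves the event
   unchanged, and the length is the range. *)
pose s n := sort <=%R (undup [seq walk X k om | k <- iota 1 n]).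
have size_s n : size (s n) = nb_sites n (steps X om) by rewrite size_sort.
have := @pr_Fset_cvg _ _ _ P2 xi stat u tau tau_lim a l D D' s (escape P1 X) _ _ _.
rewrite (_ : (fun n => pr P2 (Fset _ (s n) (u n))) = (fun n => pr P2
    [set w | forall k : nat, (1 <= k <= n)%N -> xi (walk X k om) w <= u n])).
  apply.
  - by move=> n; rewrite sort_lt_sorted undup_uniq.
  - move=> n; rewrite size_s; apply: leq_trans (size_undup _) _.
    by rewrite size_map size_iota.
  - by under eq_fun do rewrite size_s.
apply/funext => n; congr (pr P2 _); apply/seteqP; split => w /= h.
  move=> k kn; apply: h; rewrite mem_sort mem_undup; apply: map_f.
  by rewrite mem_iota; lia.
move=> i; rewrite mem_sort mem_undup => /mapP[k]; rewrite mem_iota => kn ->.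
by apply: h; lia.
Qed.
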